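(* 1) Suppose that for some neighbourhood $M\subseteq\Theta$ of $\bar\theta$ and some (possibly random) $\mathbb{R}^p$-valued function $G$ on $M$ we have both $\sup_{\theta\in M}|G_n(\theta)-G(\theta)|\to 0$ in $\mathbb{P}$-probability and, for all $\varepsilon>0$, $\mathbb{P}\big(\inf_{\theta\in M,\,|\theta-\bar\theta|>\varepsilon}|G(\theta)|>0\big)=1$. Then any sequence $(\hat\theta_n)$ of $G_n$-estimators satisfies $$\mathbb{P}\big(\hat\theta_n\in M,\ |\hat\theta_n-\bar\theta|>\varepsilon\big)\to 0\quad\text{for all }\varepsilon>0 .$$ 2) Let $\bar\theta\in\operatorname{int}\Theta$ and let $G$ be a (possibly random) $\mathbb{R}^p$-valued function on $\Theta$. Assume that for all compact subsets $M\subseteq\Theta$ the following holds: (i) $G_n(\bar\theta)\to0$ in $\mathbb{P}$-probability and $G(\bar\theta)=0$; (ii) for $\mathbb{P}$-almost all $\omega$, $G(\cdot,\omega)$ and all $G_n(\cdot,\omega)$ are continuously differentiable on $M$, and $\sup_{\theta\in M}\|\partial_\theta G_n(\theta)-\partial_\theta G(\theta)\|\to 0$ in $\mathbb{P}$-probability; (iii) $\partial_\theta G(\bar\theta)$ is non-singular with $\mathbb{P}$-probability one. Assume moreover that, $\mathbb{P}$-almost surely, $\bar\theta$ is the unique root in $\Theta$ of the equation $G(\theta)=0$. Then the conditions in 1) hold for any compact neighbourhood $M$ of $\bar\theta$. Moreover: (a) Suppose $\Theta$ is compact. Then any sequence of $G_n$-estimators is weakly $\bar\theta$-consistent, and this sequence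 is eventually unique (if $(\hat\theta_n)$ and $(\hat\theta_n')$ are two such sequences, then $\mathbb{P}(\hat\theta_n\ne\hat\theta_n')\to0$). (b) Suppose $\Theta$ is homeomorphic to $\mathbb{R}^p$, and choose any $\rho\in\Theta$. Then any sequence of $\rho$-centered $G_n$-estimators is weakly $\bar\theta$-consistent, and this sequence is eventually unique, in the sense that if $(\hat\theta_n^{\rho})$ and $(\hat\theta_n'^{\rho'})$ are two sequences of, respectively, $\rho$-centered and $\rho'$-centered $G_n$-estimators ($\rho,\rho'\in\Theta$), then $\mathbb{P}(\hat\theta_n^{\rho}\neq\hat\theta_n'^{\rho'})\to 0$.
   Context: Setting: $(\Omega,\mathcal{F},\mathbb{P})$ is a complete probability space ($\mathbb{P}$ is the true measure), $\Theta\subseteq\mathbb{R}^p$ is the parameter set, and for each $n$, $\mathcal{F}_n\subseteq\mathcal{F}$ is a $\mathbb{P}$-complete sub-$\sigma$-field (generated by the observations at stage $n$). An estimating function at stage $n$ is a map $G_n:\Theta\times\Omega\to\mathbb{R}^p$ that is measurable with respect to the product of the Borel $\sigma$-field of $\Theta$ with $\mathcal{F}_n$; the argument $\omega$ is usually suppressed. All limits are as $n\to\infty$. $G_n$-estimators: let $\delta$ be an extra point outside $\Theta$ and $\Theta_\delta=\Theta\cup\{\delta\}$. Let $D_n$ be the set of all $\omega$ for which $G_n(\theta,\omega)=0$ for at least one $\theta\in\Theta$. A $G_n$-estimator is any $\mathcal{F}_n$-measurable map $\hat\theta_n:\Omega\to\Theta_\delta$ such that $\hat\theta_n\in\Theta$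 and $G_n(\hat\theta_n)=0$ on $D_n$, and $\hat\theta_n=\delta$ on the complement of $D_n$. The metric on $\Theta_\delta$ is the Euclidean metric on $\Theta$, and the distance between $\delta$ and any point of $\Theta$ is $1$. $\rho$-centered estimators: when $\Theta$ is homeomorphic to $\mathbb{R}^p$, fix a bijective bicontinuous map $\psi:\Theta\to\mathbb{R}^p$ and put $d(\theta,\theta')=|\psi(\theta)-\psi(\theta')|$. For $\rho\in\Theta$, a $\rho$-centered $G_n$-estimator is any $\mathcal{F}_n$-measurable $\Theta_\delta$-valued variable $\hat\theta_n^\rho$ that, on $D_n$, is a minimiser of $d(\theta,\rho)$ over $\{\theta\in\Theta: G_n(\theta)=0\}$, and that equals $\delta$ on the complement of $D_n$. A sequence $(\hat\theta_n)$ is weakly $\bar\theta$-consistent if $\hat\theta_n\to\bar\theta$ in $\mathbb{P}$-probability. $|\cdot|$ is the Euclidean norm, $\|\cdot\|$ the operator norm on $p\times p$ matrices, and $\partial_\theta G$ the $p\times p$ Jacobian matrix.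
   Formalization: For (a) and for ''the conditions in 1) hold for any compact neighbourhood'', Θ is also assumed to join points of each compact subset by uniformly Lipschitz paths in a compact subset of Θ (false e.g. on [-1,1]∪[2,3]). In 1), M is Borel in Θ; in (b), Θ is stated to be open. *)

(* Defs.v *)
From HB Require Import structures.
From mathcomp Require Import all_boot all_order all_algebra.
From mathcomp Require Import all_classical all_reals all_analysis.
Set Implicit Arguments.
Unset Strict Implicit.
Unset Printing Implicit Defensive.
Import Order.TTheory GRing.Theory Num.Theory.
Import numFieldNormedType.Exports.
Local Open Scope classical_set_scope.
Local Open Scope ring_scope.

(* Points of R^p are row vectors.  The library norm `|x| on 'rV[R]_p is the
   max norm (same topology), so the Euclidean norm is defined here. *)
Definition enorm {R : realType} {p : nat} (x : 'rV[R]_p) : R :=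
  Num.sqrt (\sum_(i < p) x 0 i ^+ 2).

Definition opnorm {R : realType} {p : nat} (A : 'M[R]_p) : R :=
  sup [set enorm (v *m A) | v in [set v : 'rV[R]_p | enorm v <= 1]].

Definition borel {R : realType} {p : nat} : set (set 'rV[R]_p) :=
  <<s [set U : set 'rV[R]_p | open U] >>.

(* The product of the Borel sigma-field of R^p with a sigma-field F on T. *)
Definition borel_prod {R : realType} {p : nat} {T : Type} (F : set (set T)) :
    set (set ('rV[R]_p * T)) :=
  <<s [set B `*` A | B in borel & A in F] >>.

(* g restricted to D x T is measurable for B(D) (x) F, which is the trace of
   B(R^p) (x) F on D x T; D itself need not be Borel, and the values of g
   outside D are irrelevant. *)
Definition jointly_measurable {R : realType} {p : nat} {T : Type}
    (F : set (set T)) (D : set 'rV[R]_p) (g : 'rV[R]_p -> T -> 'rV[R]_p) : Prop :=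
  preimage_set_system (D `*` setT) (fun z : 'rV[R]_p * T => g z.1 z.2) borel
    `<=` preimage_set_system (D `*` setT) idfun (borel_prod F).

Definition complete_subfield {R : realType} {d : measure_display}
    {T : measurableType d} (P : probability T R) (F : set (set T)) : Prop :=
  [/\ sigma_algebra setT F, F `<=` measurable & P.-negligible `<=` F].

(* X n -> 0 in probability, for X n >= 0.  P^* is the outer probability, equal
   to P on measurable sets.  It is used because the X n below include suprema
   over uncountable sets: for complete P these are measurable by the projection
   theorem, and the definition should not depend on that. *)
Definition cvg_in_prob0 {R : realType} {d : measure_display}
    {T : measurableType d} (P : probability T R) (X : nat -> T -> \bar R) : Prop :=
  forall eps : R, 0 < eps ->
    (P^*)%mu [set w | (eps%:E < X n w)%E] @[n --> \oo] --> 0%E.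

Definition root_event {R : realType} {p : nat} {T : Type}
    (Theta : set 'rV[R]_p) (g : 'rV[R]_p -> T -> 'rV[R]_p) : set T :=
  [set w | exists2 x, Theta x & g x w = 0].

(* Theta_delta is encoded in option 'rV[R]_p, with None in the role of delta,
   an isolated point; hence measurability is tested on Borel sets of R^p. *)
Definition delta_measurable {R : realType} {p : nat} {T : Type}
    (F : set (set T)) (th : T -> option 'rV[R]_p) : Prop :=
  forall B, borel B -> F [set w | exists2 x, th w = Some x & B x].

Definition dist_delta {R : realType} {p : nat} (u v : option 'rV[R]_p) : R :=
  match u, v with
  | Some x, Some y => enorm (x - y)
  | None, None => 0
  | _, _ => 1
  end.

Definition is_estimator {R : realType} {p : nat} {T : Type}
    (F : set (set T)) (Theta : set 'rV[R]_p) (g : 'rV[R]_p -> T -> 'rV[R]_p)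
    (th : T -> option 'rV[R]_p) : Prop :=
  [/\ delta_measurable F th,
      forall w, root_event Theta g w ->
        exists x, [/\ th w = Some x, Theta x & g x w = 0] &
      forall w, ~ root_event Theta g w -> th w = None].

Definition homeo_to_Rp {R : realType} {p : nat}
    (Theta : set 'rV[R]_p) (psi : 'rV[R]_p -> 'rV[R]_p) : Prop :=
  [/\ set_bij Theta setT psi, {within Theta, continuous psi} &
      exists2 phi : 'rV[R]_p -> 'rV[R]_p,
        continuous phi & forall x, Theta x -> phi (psi x) = x].

Definition is_centered_estimator {R : realType} {p : nat} {T : Type}
    (F : set (set T)) (Theta : set 'rV[R]_p) (psi : 'rV[R]_p -> 'rV[R]_p)
    (rho : 'rV[R]_p) (g : 'rV[R]_p -> T -> 'rV[R]_p)
    (th : T -> option 'rV[R]_p) : Prop :=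
  [/\ delta_measurable F th,
      forall w, root_event Theta g w ->
        exists x, [/\ th w = Some x, Theta x, g x w = 0 &
          forall y, Theta y -> g y w = 0 ->
            enorm (psi x - psi rho) <= enorm (psi y - psi rho)] &
      forall w, ~ root_event Theta g w -> th w = None].

Definition weakly_consistent {R : realType} {p : nat} {d : measure_display}
    {T : measurableType d} (P : probability T R) (thbar : 'rV[R]_p)
    (th : nat -> T -> option 'rV[R]_p) : Prop :=
  cvg_in_prob0 P (fun n w => (dist_delta (th n w) (Some thbar))%:E).

(* Derivatives of functions on Theta are taken relative to Theta, so that
   boundary points make sense; at interior points this is 'J g x.  As with 'J,
   the matrix acts on row vectors from the right, so it is the transpose of
   the matrix of partial derivatives (dg_i/dx_j)_(i, j), which has the same
   operator norm and the same invertibility. *)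
Definition jacobian_in {R : realType} {p : nat} (Theta : set 'rV[R]_p)
    (g : 'rV[R]_p -> 'rV[R]_p) (x : 'rV[R]_p) : 'M[R]_p :=
  lin1_mx ('d g (within Theta (nbhs x))).

Definition C1_on {R : realType} {p : nat} (Theta M : set 'rV[R]_p)
    (g : 'rV[R]_p -> 'rV[R]_p) : Prop :=
  (forall x, M x -> differentiable g (within Theta (nbhs x))) /\
  {within M, continuous (jacobian_in Theta g)}.

(* Compact subsets of Theta are joined inside compact subsets of Theta by
   paths of bounded length.  Every open connected set and every convex set has
   this property.  Without it, closeness of derivatives and of the values at
   one point does not control functions on Theta: on [-1, 1] U [2, 3], take
   g x = x and g_n x = x on [-1, 1], x - 5/2 on [2, 3].  Connectedness would
   not suffice for compact Theta (spirals of infinite length). *)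
Definition bounded_arcs {R : realType} {p : nat} (Theta : set 'rV[R]_p) : Prop :=
  forall M, compact M -> M `<=` Theta ->
    exists N : set 'rV[R]_p, exists k : R,
      [/\ compact N, N `<=` Theta &
          forall x y, M x -> M y ->
            exists c : R -> 'rV[R]_p,
              [/\ c 0 = x, c 1 = y, c @` `[0, 1] `<=` N &
                  k.-lipschitz_(`[0, 1]) c]].

Definition unif_cvg_in_prob {R : realType} {p : nat} {d : measure_display}
    {T : measurableType d} (P : probability T R) (M : set 'rV[R]_p)
    (Gn : nat -> 'rV[R]_p -> T -> 'rV[R]_p) (G : 'rV[R]_p -> T -> 'rV[R]_p) : Prop :=
  cvg_in_prob0 P
    (fun n w => ereal_sup [set (enorm (Gn n x w - G x w))%:E | x in M]).

Definition well_separated {R : realType} {p : nat} {d : measure_display}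
    {T : measurableType d} (P : probability T R) (M : set 'rV[R]_p)
    (thbar : 'rV[R]_p) (G : 'rV[R]_p -> T -> 'rV[R]_p) : Prop :=
  forall eps : R, 0 < eps ->
    {ae P, forall w,
      (0 < ereal_inf [set (enorm (G x w))%:E |
                       x in [set x | M x /\ (eps < enorm (x - thbar))%R]])%E}.

(* Main.v *)
Require Import Defs.
From HB Require Import structures.
From mathcomp Require Import all_boot all_order all_algebra.
From mathcomp Require Import all_classical all_reals all_analysis.
From mathcomp Require Import lra.
Set Implicit Arguments.
Unset Strict Implicit.
Unset Printing Implicit Defensive.
Import Order.TTheory GRing.Theory Num.Theory.
Import numFieldNormedType.Exports.
Local Open Scope classical_set_scope.
Local Open Scope ring_scope.

(* Bad events are controlled pathwise.  If X_n -> 0 in outer probability, the A_n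
   are measurable, and almost every w has a delta > 0 with X_n(w) >= delta
   whenever w is in A_n, then P(A_n) -> 0 (prob_cvg0); neither the X_n nor the
   random threshold delta need be measurable, so no projection theorem is used.

   Pathwise, the mean value inequality along rectifiable arcs (or polygons)
   turns closeness of the derivatives and of the value at thbar into uniform
   closeness of G_n and G on a compact M.  Compactness then keeps the roots of
   G_n in M close to thbar, and near thbar the simplified Newton map
   x |-> x - G_n(x) J^-1, with J the derivative of G at thbar, is a contraction,
   so that G_n has exactly one root there.  When Theta is homeomorphic to R^p, a
   root nearest to rho is at most as far from rho as the root near thbar, so it
   lies in a fixed compact set, in which the root is unique. *)

(** * Euclidean and operator norms *)

Lemma coord_le_norm {R : realType} {p : nat} (v : 'rV[R]_p) i : `|v 0 i| <= `|v|.
Proof.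
rewrite [leRHS]/Num.norm /= mx_normrE; apply/bigmax_geP; right => /=.
by exists (0, i).
Qed.

Lemma norm_le_coords {R : realType} {p : nat} (v : 'rV[R]_p) (e : R) :
  0 <= e -> (forall i, `|v 0 i| <= e) -> `|v| <= e.
Proof.
move=> e0 ve; rewrite [leLHS]/Num.norm /= mx_normrE; apply/bigmax_leP; split => //=.
by move=> [i j] _ /=; rewrite ord1.
Qed.

Lemma entry_le_norm {R : realType} {m n : nat} (A : 'M[R]_(m, n)) i j :
  `|A i j| <= `|A|.
Proof.
rewrite [leRHS]/Num.norm /= mx_normrE; apply/bigmax_geP; right => /=.
by exists (i, j).
Qed.

Lemma enorm_ge0 {R : realType} {p : nat} (v : 'rV[R]_p) : 0 <= enorm v.
Proof. exact: sqrtr_ge0. Qed.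

Lemma norm_le_enorm {R : realType} {p : nat} (v : 'rV[R]_p) : `|v| <= enorm v.
Proof.
apply: norm_le_coords (enorm_ge0 v) _ => i.
rewrite -sqrtr_sqr ler_wsqrtr// (bigD1 i)//= lerDl.
by apply: sumr_ge0 => j _; exact: sqr_ge0.
Qed.

(** The crude factor [p + 1], in place of the square root of [p], is positive even for [p = 0], so
    it can be divided by later. *)
Lemma enorm_le_norm {R : realType} {p : nat} (v : 'rV[R]_p) :
  enorm v <= (p%:R + 1) * `|v|.
Proof.
have p0 : 0 <= p%:R :> R by exact: ler0n.
rewrite -[leRHS]ger0_norm ?mulr_ge0 ?addr_ge0// -sqrtr_sqr ler_wsqrtr//.
apply: (@le_trans _ _ (\sum_(i < p) `|v| ^+ 2)).
  apply: ler_sum => i _; rewrite -real_normK ?num_real// lerXn2r ?nnegrE//.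
  exact: coord_le_norm.
rewrite sumr_const card_ord -[_ *+ p]mulr_natl exprMn ler_wpM2r ?sqr_ge0//.
by nra.
Qed.

Lemma enormZ {R : realType} {p : nat} (a : R) (v : 'rV[R]_p) :
  enorm (a *: v) = `|a| * enorm v.
Proof.
rewrite /enorm -sqrtr_sqr -sqrtrM ?sqr_ge0// mulr_sumr.
by under eq_bigr do rewrite mxE exprMn.
Qed.

Lemma enorm_eq0 {R : realType} {p : nat} (v : 'rV[R]_p) : enorm v = 0 -> v = 0.
Proof.
by move=> v0; apply/normr0_eq0/le_anti; rewrite normr_ge0 -v0 norm_le_enorm.
Qed.

Lemma enorm0 {R : realType} {p : nat} : enorm (0 : 'rV[R]_p) = 0.
Proof. by rewrite -[0](scale0r 0) enormZ normr0 mul0r. Qed.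

(** A bound for the operator norm induced by the max norm, in which neighbourhoods and differentials
    are expressed. As a predicate it avoids any question of whether a supremum is finite. *)
Definition opbound {R : realType} {p : nat} (A : 'M[R]_p) (e : R) : Prop :=
  forall v : 'rV[R]_p, `|v *m A| <= e * `|v|.

Lemma opbound_le {R : realType} {p : nat} (A : 'M[R]_p) (e e' : R) :
  e <= e' -> opbound A e -> opbound A e'.
Proof.
by move=> ee' Ae v; apply: (le_trans (Ae v)); rewrite ler_wpM2r.
Qed.

Lemma opboundD {R : realType} {p : nat} (A B : 'M[R]_p) (e e' : R) :
  opbound A e -> opbound B e' -> opbound (A + B) (e + e').
Proof.
move=> Ae Be v; rewrite mulmxDr mulrDl.
by rewrite (le_trans (ler_normD _ _))// lerD.
Qed.

Lemma opbound_norm {R : realType} {p : nat} (A : 'M[R]_p) :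
  opbound A (p%:R * `|A|).
Proof.
move=> v; apply: norm_le_coords => [|j]; first by rewrite !mulr_ge0.
rewrite mxE (le_trans (ler_norm_sum _ _ _))//.
apply: (@le_trans _ _ (\sum_(i < p) `|A| * `|v|)).
  apply: ler_sum => i _; rewrite normrM mulrC ler_pM//; first exact: entry_le_norm.
  exact: coord_le_norm.
by rewrite sumr_const card_ord -[_ *+ p]mulr_natl mulrA.
Qed.

Lemma opbound_exists {R : realType} {p : nat} (A : 'M[R]_p) :
  exists2 b : R, 0 < b & opbound A b.
Proof.
exists (p%:R * `|A| + 1); first by rewrite ltr_wpDl// mulr_ge0.
by apply: opbound_le (opbound_norm A); rewrite lerDl.
Qed.

(** By homogeneity it suffices to test [v / enorm v], a point of the unit ball. That the real
    supremum is an upper bound also requires the set to be bounded, which [opbound_norm] gives. *)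
Lemma opnorm_ge {R : realType} {p : nat} (A : 'M[R]_p) (v : 'rV[R]_p) :
  enorm (v *m A) <= opnorm A * enorm v.
Proof.
have p0 : 0 <= p%:R + 1 :> R by rewrite addr_ge0.
have [v0|vn0] := eqVneq (enorm v) 0.
  by rewrite (enorm_eq0 v0) mul0mx enorm0 mulr0.
have v0 : 0 < enorm v by rewrite lt_def vn0 enorm_ge0.
rewrite -ler_pdivrMr// mulrC -[_^-1]ger0_norm ?invr_ge0 ?enorm_ge0//.
rewrite -enormZ scalemxAl; apply: ub_le_sup; last first.
  by exists ((enorm v)^-1 *: v) => //=; rewrite enormZ ger0_norm ?invr_ge0 ?enorm_ge0// mulVf.
exists ((p%:R + 1) * (p%:R * `|A|)) => _ [w /= w1 <-].
apply: (le_trans (enorm_le_norm _)); rewrite ler_wpM2l//.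
apply: (le_trans (opbound_norm A w)); rewrite ler_piMr ?mulr_ge0//.
exact: le_trans (norm_le_enorm w) w1.
Qed.

Lemma opbound_opnorm {R : realType} {p : nat} (A : 'M[R]_p) (e : R) :
  0 <= e -> opnorm A <= e -> opbound A ((p%:R + 1) * e).
Proof.
move=> e0 Ae v; apply: le_trans (norm_le_enorm _) _; apply: le_trans (opnorm_ge A v) _.
apply: (@le_trans _ _ (e * enorm v)); first by rewrite ler_wpM2r ?enorm_ge0.
by rewrite mulrAC [leRHS]mulrC ler_wpM2l//; exact: enorm_le_norm.
Qed.

(** * Derivatives relative to a set and mean value inequalities *)

Lemma near_dist_lt {R : realType} {V : normedModType R} (x : V) (r : R) :
  0 < r -> \forall y \near x, `|y - x| < r.
Proof.
move=> r0; apply: filterS (nbhsx_ballx x r r0) => y.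
by rewrite -ball_normE /ball_ /= distrC.
Qed.

(** Being a relation with an explicit matrix, it asks for no uniqueness of the derivative and passes
    directly to differences. *)
Definition derivative_in {R : realType} {p : nat} (Theta : set 'rV[R]_p)
    (g : 'rV[R]_p -> 'rV[R]_p) (x : 'rV[R]_p) (A : 'M[R]_p) : Prop :=
  forall e : R, 0 < e -> \forall y \near x, Theta y ->
    `|g y - g x - (y - x) *m A| <= e * `|y - x|.

Lemma jacobian_in_derivative {R : realType} {p : nat} (Theta : set 'rV[R]_p)
    (g : 'rV[R]_p -> 'rV[R]_p) (x : 'rV[R]_p) :
  Theta x -> differentiable g (within Theta (nbhs x)) ->
  derivative_in Theta g x (jacobian_in Theta g x).
Proof.
move=> Tx [[_]]; have PF : ProperFilter (within Theta (nbhs x)).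
  apply: within_nbhs_proper; exact: subset_closure.
have limx : lim (within Theta (nbhs x)) = x.
  apply: (@cvg_lim _ (@norm_hausdorff _ _) _ _ PF id).
  by apply: cvg_within.
rewrite [lim _]limx => /eqaddoP gx e e0; have /= := gx e e0.
rewrite near_withinE => gxe; apply: filterS gxe => y /[apply].
by rewrite /jacobian_in mul_rV_lin1 !fctE /= opprD addrA.
Qed.

Lemma derivative_inB {R : realType} {p : nat} (Theta : set 'rV[R]_p)
    (g h : 'rV[R]_p -> 'rV[R]_p) (x : 'rV[R]_p) (A B : 'M[R]_p) :
  derivative_in Theta g x A -> derivative_in Theta h x B ->
  derivative_in Theta (fun y => g y - h y) x (A - B).
Proof.
move=> gA hB e e0; have e20 : 0 < e / 2 by rewrite divr_gt0.
apply: (filterS2 _ _ (gA _ e20) (hB _ e20)) => y gy hy Ty.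
have -> : g y - h y - (g x - h x) - (y - x) *m (A - B) =
    (g y - g x - (y - x) *m A) - (h y - h x - (y - x) *m B).
  rewrite mulmxBr; move: (_ *m A) (_ *m B) => a b.
  by apply/rowP => i; rewrite !mxE; lra.
rewrite (le_trans (ler_normB _ _))//.
have := gy Ty; have := hy Ty; move: `|_ - _ - _| `|_ - _ - _| => a b.
by lra.
Qed.

Lemma derivative_in_linear {R : realType} {p : nat} (Theta : set 'rV[R]_p)
    (x : 'rV[R]_p) (A : 'M[R]_p) :
  derivative_in Theta (mulmx ^~ A) x A.
Proof.
move=> e e0; apply: (@nearW _ (nbhs x)) => y _.
by rewrite -mulmxBl subrr normr0 mulr_ge0// ltW.
Qed.

Lemma derivative_in_lipschitz {R : realType} {p : nat} (Theta : set 'rV[R]_p)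
    (g : 'rV[R]_p -> 'rV[R]_p) (x : 'rV[R]_p) (A : 'M[R]_p) (b e : R) :
  derivative_in Theta g x A -> opbound A b -> 0 < e ->
  \forall y \near x, Theta y -> `|g y - g x| <= (b + e) * `|y - x|.
Proof.
move=> gA Ab e0; apply: filterS (gA _ e0) => y gy Ty.
rewrite -(subrK ((y - x) *m A) (g y - g x)) (le_trans (ler_normD _ _))//.
by rewrite addrC mulrDl lerD ?Ab ?gy.
Qed.

Lemma derivative_in_continuous {R : realType} {p : nat} (Theta M : set 'rV[R]_p)
    (g : 'rV[R]_p -> 'rV[R]_p) (A : 'rV[R]_p -> 'M[R]_p) :
  M `<=` Theta -> (forall x, M x -> derivative_in Theta g x (A x)) ->
  {within M, continuous g}.
Proof.
move=> MT gA; apply/subspace_continuousP => x Mx.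
have [b b0 Ab] := opbound_exists (A x).
apply/cvgrPdist_le => e e0.
have := derivative_in_lipschitz (gA x Mx) Ab ltr01.
have : \forall y \near x, `|y - x| < e / (b + 1).
  by apply: near_dist_lt; rewrite divr_gt0// addr_gt0.
apply: (filterS2 _) => y yx gy My.
by rewrite distrC (le_trans (gy (MT _ My)))// mulrC -ler_pdivlMr ?addr_gt0// ltW.
Qed.

(* The supremum of [t | |f t - f 0| <= L t] belongs to the set and is 1. *)
Lemma local_lipschitz_unit_interval {R : realType} {V : normedModType R}
    (f : R -> V) (L : R) :
  (forall s : R, s \in `[0, 1]%R -> \forall t \near s,
     t \in `[0, 1]%R -> `|f t - f s| <= L * `|t - s|) ->
  `|f 1 - f 0| <= L.
Proof.
move=> fL; pose S := [set t : R | t \in `[0, 1]%R /\ `|f t - f 0| <= L * t].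
have S0 : S 0 by rewrite /S /= subrr normr0 mulr0 in_itv/= lexx ler01.
have supS : has_sup S.
  by split; [exists 0 | exists 1 => t [/[!in_itv]/= /andP[]]].
pose s := sup S.
have s0 : 0 <= s by exact: (ub_le_sup supS.2).
have s1 : s <= 1.
  by apply: ge_sup; [exists 0 | move=> t [/[!in_itv]/= /andP[]]].
have s01 : s \in `[0, 1]%R by rewrite in_itv/= s0 s1.
have /nbhs_ballP[e /= e0 fs] := fL _ s01.
have Ss : S s.
  split => //; have [t St ts] := sup_adherent e0 supS.
  have ts' : t <= s by exact: (ub_le_sup supS.2).
  have : `|f t - f s| <= L * `|t - s|.
    by apply: fs St.1; rewrite /ball /= ger0_norm ?subr_ge0//; rewrite -/s in ts; lra.
  rewrite (distrC t) ger0_norm ?subr_ge0// distrC => fst.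
  rewrite -(subrKA (f t)) (le_trans (ler_normD _ _))//.
  by have := St.2; lra.
have [s1'|] := ltP s 1; last first.
  by move=> s1'; have := Ss.2; rewrite (le_anti (introT andP (conj s1 s1'))) mulr1.
(* The increment [e / 2] keeps [t] where the local estimate at [s] holds, and the minimum keeps it
   in the interval; [t] then lies in [S] beyond its supremum. *)
pose t := Num.min 1 (s + e / 2).
have st : s < t by rewrite /t lt_min s1'/= ltrDl divr_gt0.
have t1 : t \in `[0, 1]%R by rewrite in_itv/= ge_min lexx/= (le_trans s0)// ltW.
have ts : t <= s + e / 2 by rewrite /t ge_min lexx orbT.
suff St : S t by have := ub_le_sup supS.2 St; rewrite leNgt -/s st.
split => //; have : `|f t - f s| <= L * `|t - s|.
  by apply: fs t1; rewrite /ball /= distrC gtr0_norm ?subr_gt0//; lra.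
rewrite gtr0_norm ?subr_gt0// => fts.
rewrite -(subrKA (f s)) (le_trans (ler_normD _ _))//.
by have := Ss.2; lra.
Qed.

(** The arc is only Lipschitz, so [h \o c] need not be differentiable; but near every parameter it
    is Lipschitz with constant [(e + d) * k] for any [d > 0], and this local information suffices on
    an interval. *)
Lemma mean_value_arc {R : realType} {p : nat} (Theta N : set 'rV[R]_p)
    (h : 'rV[R]_p -> 'rV[R]_p) (A : 'rV[R]_p -> 'M[R]_p) (c : R -> 'rV[R]_p)
    (k e : R) :
  N `<=` Theta -> (forall x, N x -> derivative_in Theta h x (A x)) ->
  0 <= e -> (forall x, N x -> opbound (A x) e) ->
  0 <= k -> c @` `[0, 1] `<=` N -> k.-lipschitz_(`[0, 1]) c ->
  `|h (c 1) - h (c 0)| <= e * k.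
Proof.
move=> NT hA e0 Ae k0 cN ck; apply/ler_addgt0Pr => _/posnumP[eta].
(* Chosen so that [d * k <= eta]; the 1 in the denominator covers [k = 0]. *)
pose d := eta%:num / (k + 1).
have d0 : 0 < d by rewrite divr_gt0// ltr_wpDl.
apply: (@le_trans _ _ ((e + d) * k)); last first.
  rewrite mulrDl lerD2l /d mulrAC ler_pdivrMr ?ltr_wpDl//.
  by rewrite ler_wpM2l// lerDl.
apply: (@local_lipschitz_unit_interval _ _ (h \o c)) => s s01.
have Ncs : N (c s) by apply: cN; exists s.
have cs : \forall t \near s, t \in `[0, 1]%R -> `|c t - c s| <= k * `|t - s|.
  by apply: (@nearW _ (nbhs s)) => t t01; exact: (ck (t, s)).
have := derivative_in_lipschitz (hA _ Ncs) (Ae _ Ncs) d0.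
move=> /nbhs_ballP[r /= r0 hr].
have sr : \forall t \near s, `|t - s| < r / (k + 1).
  by apply: near_dist_lt; rewrite divr_gt0// ltr_wpDl.
apply: (filterS2 _ _ cs sr) => t /[swap] tr /[swap] t01 /(_ t01) ct.
apply: (@le_trans _ _ ((e + d) * `|c t - c s|)); last first.
  by rewrite -mulrA ler_wpM2l// addr_ge0// ltW.
apply: hr; last by apply: NT; apply: cN; exists t.
rewrite -ball_normE /ball_ /= distrC (le_lt_trans ct)//.
have k1 : 0 < k + 1 by rewrite ltr_wpDl.
rewrite ltr_pdivlMr// in tr; apply: le_lt_trans tr.
by rewrite mulrC ler_wpM2l// lerDl.
Qed.

Lemma mean_value_segment {R : realType} {p : nat} (Theta N : set 'rV[R]_p)
    (h : 'rV[R]_p -> 'rV[R]_p) (A : 'rV[R]_p -> 'M[R]_p) (e : R)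
    (x y : 'rV[R]_p) :
  N `<=` Theta -> (forall x, N x -> derivative_in Theta h x (A x)) ->
  0 <= e -> (forall x, N x -> opbound (A x) e) ->
  (forall t : R, t \in `[0, 1]%R -> N (x + t *: (y - x))) ->
  `|h y - h x| <= e * `|y - x|.
Proof.
move=> NT hA e0 Ae xyN; pose c t := x + t *: (y - x).
have := mean_value_arc (c := c) (k := `|y - x|) NT hA e0 Ae.
rewrite /c scale1r scale0r addr0 subrKC; apply => //.
- by move=> _ [t t01 <-]; exact: xyN.
- move=> [s t] _ /=.
  by rewrite opprD addrACA subrr add0r -scalerBl normrZ mulrC.
Qed.

(** * Roots of perturbed functions *)

Lemma compact_closed_ball_rV {R : realType} {p : nat} (x : 'rV[R]_p) (r : R) :
  0 < r -> compact [set y : 'rV[R]_p | `|y - x| <= r].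
Proof.
move=> r0; apply: bounded_closed_compact.
  exists (r + `|x|); split; first exact: num_real.
  move=> M rM y yr /=; rewrite -(subrK x y) (le_trans (ler_normD _ _))//.
  by rewrite (le_trans _ (ltW rM))// lerD2r.
have -> : [set y : 'rV[R]_p | `|y - x| <= r] = closed_ball x r.
  rewrite closed_ballE// /closed_ball_; apply/seteqP.
  by split=> y /=; rewrite distrC.
exact: closed_ball_closed.
Qed.

(** * The simplified Newton map on a ball *)

Section newton_map.
Context {R : realType} {p : nat}.
Variables (Theta : set 'rV[R]_p) (h : 'rV[R]_p -> 'rV[R]_p)
  (A : 'rV[R]_p -> 'M[R]_p) (J : 'M[R]_p) (x0 : 'rV[R]_p) (r b q : R).
Let B := [set x : 'rV[R]_p | `|x - x0| <= r].
Hypotheses (BTheta : B `<=` Theta)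
  (hA : forall x, B x -> derivative_in Theta h x (A x))
  (AJ : forall x, B x -> opbound (A x - J) q)
  (Junit : J \in unitmx) (Jb : opbound (invmx J) b)
  (q0 : 0 <= q) (b0 : 0 <= b) (bq : b * q <= 1 / 2).
Let newton x := x - h x *m invmx J.

(** Up to sign and the factor [invmx J], the increment of the Newton map is that of
    [z |-> h z - z *m J], whose derivative [A - J] is bounded by [q] on the convex ball; the
    contraction factor is then [b * q]. *)
Lemma newton_contracting x y :
  B x -> B y -> `|newton y - newton x| <= 1 / 2 * `|y - x|.
Proof.
move=> Bx By; pose k z := h z - z *m J.
have kyx : `|k y - k x| <= q * `|y - x|.
  apply: (mean_value_segment BTheta _ q0 AJ) => [z Bz|t].
    exact: derivative_inB (hA Bz) (@derivative_in_linear _ _ Theta z J).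
  rewrite in_itv/= => /andP[t0 t1]; rewrite /B /=.
  have -> : x + t *: (y - x) - x0 = (1 - t) *: (x - x0) + t *: (y - x0).
    by apply/rowP => i; rewrite !mxE; lra.
  rewrite (le_trans (ler_normD _ _))// !normrZ !ger0_norm ?subr_ge0//.
  by move: Bx By; rewrite /B /= => Bx By; nra.
have -> : newton y - newton x = - (k y - k x) *m invmx J.
  rewrite /newton /k mulNmx !mulmxBl !mulmxK//.
  by move: (_ *m _) (_ *m _) => u v; apply/rowP => i; rewrite !mxE; lra.
rewrite (le_trans (Jb _))// normrN (le_trans (ler_wpM2l b0 kyx))//.
by rewrite mulrA ler_wpM2r.
Qed.

Lemma newton_fixed x : h x = 0 -> newton x = x.
Proof. by move=> hx; rewrite /newton hx mul0mx subr0. Qed.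

Lemma root_unique_ball x y : B x -> B y -> h x = 0 -> h y = 0 -> y = x.
Proof.
move=> Bx By hx hy; have := newton_contracting Bx By.
rewrite !newton_fixed// => yx; apply/eqP; rewrite -subr_eq0 -normr_le0.
by lra.
Qed.

(* A minimiser of [x |-> |h x *m invmx J| = |newton x - x|] on the ball is a
   root, as one Newton step would halve this quantity. *)
Lemma root_exists_ball : 0 < r -> b * `|h x0| <= r / 2 ->
  exists2 x, B x & h x = 0.
Proof.
move=> r0 hx0; pose f x := `|x - newton x|.
have Bx0 : B x0 by rewrite /B /= subrr normr0 ltW.
have cB : compact B. exact: compact_closed_ball_rV.
have fE x : f x = `|h x *m invmx J| by rewrite /f /newton subKr.
have cf : {within B, continuous f}.
  apply/subspace_continuousP => x Bx; apply/cvgrPdist_le => e e0.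
  have /subspace_continuousP/(_ x Bx)/cvgrPdist_le := derivative_in_continuous BTheta hA.
  have b1 : 0 < b + 1 by rewrite ltr_wpDl.
  move=> /(_ (e / (b + 1))); rewrite divr_gt0// => /(_ isT).
  apply: filterS => y; rewrite /from_subspace !fE => hxy; rewrite (le_trans (ler_dist_dist _ _))//.
  rewrite -mulmxBl (le_trans (Jb _))//.
  rewrite ler_pdivlMr// mulrC in hxy; apply: le_trans hxy.
  by rewrite ler_wpM2r// lerDl.
have [x /set_mem Bx fx] := EVT_min_rV (ex_intro _ x0 Bx0) cB cf.
(* The ball is stable: [newton x0] is within [r / 2] of [x0], and [newton x] within [r / 2] of
   [newton x0]. *)
exists x => //; have Bnx : B (newton x).
  rewrite /B /= -(subrK (newton x0) (newton x)) -addrA.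
  rewrite (le_trans (ler_normD _ _))//.
  have := newton_contracting Bx0 Bx.
  have : `|newton x0 - x0| <= r / 2.
    by rewrite distrC -/(f x0) fE (le_trans (Jb _)).
  by move: Bx; rewrite /B /=; lra.
have := fx _ (mem_set Bnx); have := newton_contracting Bx Bnx.
rewrite {2}/f distrC => fnx fxn.
have /normr0_eq0 : `|newton x - x| = 0.
  apply/le_anti; rewrite normr_ge0 andbT.
  by move: fxn; rewrite /f distrC; move: fnx; lra.
rewrite /newton addrAC subrr add0r => /eqP; rewrite oppr_eq0 => /eqP hJ.
by rewrite -(mulmxK Junit (h x)) -[_ *m J *m _]mulmxA mulmxV// mulmx1
  -[h x](mulmxKV Junit) hJ mul0mx.
Qed.

End newton_map.

(** The part of [M] outside the open ball is compact, so [|g|] attains there a minimum, which is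
    positive as [g] has no root there. If that part is empty, any [delta] serves. *)
Lemma root_separation {R : realType} {p : nat} (M : set 'rV[R]_p)
    (g : 'rV[R]_p -> 'rV[R]_p) (x0 : 'rV[R]_p) (eps : R) :
  compact M -> {within M, continuous g} ->
  (forall x, M x -> g x = 0 -> x = x0) -> 0 < eps ->
  exists2 delta : R, 0 < delta &
    forall x, M x -> eps <= `|x - x0| -> delta <= `|g x|.
Proof.
move=> cM cg gx0 eps0; pose K := M `&` [set x | eps <= `|x - x0|].
have cK : compact K.
  apply: compact_closedI => //; rewrite (_ : [set _ | _] = ~` ball x0 eps).
    by apply: open_closedC; exact: ball_open.
  apply/seteqP; split=> x /=; rewrite -ball_normE /ball_ /= distrC leNgt => /negP//.
have [K0|/nonemptyPn K0] := pselect (K !=set0); last first.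
  by exists 1 => // x Mx ex; have : K x by []; rewrite K0.
have cgK : {within K, continuous (fun x => `|g x|)}.
  apply/subspace_continuousP => x Kx; apply: cvg_norm.
  have : {within K, continuous g} by apply: continuous_subspaceW cg => y [].
  by move/subspace_continuousP; exact.
have [x /set_mem[Mx ex] gx] := EVT_min_rV K0 cK cgK.
exists `|g x|.
  rewrite normr_gt0; apply/eqP => /(gx0 _ Mx) xx0.
  by move: ex; rewrite /= xx0 subrr normr0 leNgt eps0.
by move=> y My ey; apply: gx; apply/mem_set.
Qed.

(** The constant depends on the sets only, hence is common to all [n] and all sample points. [N] may
    exceed [M], since paths joining points of [M] may leave [M]. *)
Definition mean_value_on {R : realType} {p : nat} (Theta M N : set 'rV[R]_p)
    (C : R) : Prop :=
  forall (h : 'rV[R]_p -> 'rV[R]_p) (A : 'rV[R]_p -> 'M[R]_p) (e : R),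
    (forall x, N x -> derivative_in Theta h x (A x)) ->
    0 <= e -> (forall x, N x -> opbound (A x) e) ->
    forall x y, M x -> M y -> `|h y - h x| <= C * e.

(** Existence comes from the Newton map on a small ball around [x0]. A root [y] of [h] in [M]
    outside this ball would satisfy [d1 <= |g y|] by separation, whereas the mean value inequality
    for [h - g] gives [|g y| <= (C + 1) * delta < d1]. The threshold does not depend on [h], so it
    serves all [n] at once. *)
Lemma perturbed_root {R : realType} {p : nat} (Theta M N : set 'rV[R]_p)
    (C : R) (g : 'rV[R]_p -> 'rV[R]_p) (J : 'rV[R]_p -> 'M[R]_p)
    (x0 : 'rV[R]_p) (eps : R) :
  M `<=` N -> N `<=` Theta -> compact M -> nbhs x0 M ->
  0 <= C -> mean_value_on Theta M N C ->
  (forall x, N x -> derivative_in Theta g x (J x)) ->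
  J x @[x --> x0] --> J x0 -> J x0 \in unitmx ->
  g x0 = 0 -> (forall x, M x -> g x = 0 -> x = x0) -> 0 < eps ->
  exists2 delta : R, 0 < delta &
    forall (h : 'rV[R]_p -> 'rV[R]_p) (A : 'rV[R]_p -> 'M[R]_p),
      (forall x, N x -> derivative_in Theta h x (A x)) ->
      `|h x0| <= delta -> (forall x, N x -> opbound (A x - J x) delta) ->
      exists x, [/\ M x, h x = 0, `|x - x0| <= eps &
                    forall y, M y -> h y = 0 -> y = x].
Proof.
move=> MN NT cM Mx0 C0 mvN gJ Jcvg Junit gx0 gM eps0.
have MT : M `<=` Theta by apply: subset_trans MN NT.
have [b b0 Jb] := opbound_exists (invmx (J x0)).
(* With [b * q = 1 / 4], the allowance [1 / 2] of the contraction splits evenly between the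
   oscillation of [J] on the ball and the error [A - J]. *)
pose q := (4 * b)^-1; have q0 : 0 < q by rewrite invr_gt0 mulr_gt0.
have bqE : b * q = 1 / 4 by rewrite /q invfM mulrCA divff ?gt_eqF// mulr1 div1r.
have p1 : 0 < p%:R + 1 :> R by rewrite ltr_wpDl.
have [r [r0 reps rM rJ]] : exists r, [/\ 0 < r, r <= eps,
    forall x, `|x - x0| <= r -> M x &
    forall x, `|x - x0| <= r -> opbound (J x - J x0) q].
  have /cvgrPdist_le/(_ (q / (p%:R + 1))) := Jcvg.
  rewrite divr_gt0// => /(_ isT) JJ.
  have /nbhs_ballP[s /= s0 sP] : nbhs x0 (M `&`
      [set x | `|J x0 - J x| <= q / (p%:R + 1)]) by apply: filterI.
  have sx x : `|x - x0| <= Num.min eps (s / 2) -> ball x0 s x.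
    rewrite le_min => /andP[_ xs]; rewrite -ball_normE /ball_ /= distrC.
    by rewrite (le_lt_trans xs)//; lra.
  exists (Num.min eps (s / 2)); split=> [||x /sx/sP[]//|x /sx/sP[_ /= Jx]].
  - by rewrite lt_min eps0/= divr_gt0.
  - by rewrite ge_min lexx.
  - apply: opbound_le (opbound_norm _).
    move: Jx; rewrite distrC ler_pdivlMr// => Jx; apply: le_trans Jx.
    by rewrite mulrC ler_wpM2l// lerDl.
have [d1 d10 gsep] := root_separation cM (derivative_in_continuous MT
  (fun x Mx => gJ x (MN x Mx))) gM r0.
(* The three terms bound, in order, the error of the derivative, the first Newton step from [x0],
   and the size of [g] at roots of [h]. *)
pose delta := Num.min q (Num.min (r / (2 * b)) (d1 / (2 * (C + 1)))).
have C1 : 0 < C + 1 by rewrite ltr_wpDl.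
have delta0 : 0 < delta by rewrite !lt_min q0 !divr_gt0// mulr_gt0.
have delta_q : delta <= q by rewrite ge_min lexx.
have delta_r : b * delta <= r / 2.
  rewrite mulrC -ler_pdivlMr// -mulrA -invfM.
  by rewrite !ge_min lexx orbT.
have delta_d : (C + 1) * delta < d1.
  rewrite mulrC -ltr_pdivlMr// (@le_lt_trans _ _ (d1 / (2 * (C + 1))))//.
    by rewrite !ge_min lexx !orbT.
  by rewrite ltr_pM2l// ltf_pV2 ?posrE ?mulr_gt0// ltr_pMl// ltr1n.
exists delta => // h A hA hx0 AJ.
pose B := [set x : 'rV[R]_p | `|x - x0| <= r].
have BM : B `<=` M by move=> x /rM.
have BT : B `<=` Theta by apply: subset_trans BM MT.
have hAB x : B x -> derivative_in Theta h x (A x) by move=> /BM/MN/hA.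
have AJB x : B x -> opbound (A x - J x0) (q + q).
  move=> Bx; rewrite -(subrKA (J x)); apply: opboundD; last exact: rJ.
  exact: opbound_le delta_q (AJ _ (MN _ (BM _ Bx))).
have q20 : 0 <= q + q by rewrite addr_ge0// ltW.
have bq2 : b * (q + q) <= 1 / 2 by rewrite mulrDr bqE; lra.
have [|x Bx hx] := root_exists_ball BT hAB AJB Junit Jb q20 (ltW b0) bq2 r0.
  by rewrite (le_trans _ delta_r)// ler_wpM2l// ltW.
exists x; split => //; [exact: BM|exact: le_trans Bx reps|].
move=> y My hy.
apply: (root_unique_ball BT hAB AJB Junit Jb q20 (ltW b0) bq2 Bx) => //.
rewrite /B /= leNgt; apply/negP => /ltW/(gsep y My); apply/negP; rewrite -ltNge.
apply: le_lt_trans delta_d.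
have := mvN (fun z => h z - g z) (fun z => A z - J z) delta.
move=> /(_ (fun z Nz => derivative_inB (hA z Nz) (gJ z Nz)) (ltW delta0) AJ).
move=> /(_ x0 y (nbhs_singleton Mx0) My) /=; rewrite hy gx0 subr0 sub0r => hg.
have -> : `|g y| = `|- g y - h x0 + h x0| by rewrite subrK normrN.
by rewrite (le_trans (ler_normD _ _))// mulrDl mul1r lerD.
Qed.

(** * Mean value inequalities on compact subsets of [Theta] *)

Lemma bounded_arcs_mean_value {R : realType} {p : nat} (Theta M : set 'rV[R]_p) :
  bounded_arcs Theta -> compact M -> M `<=` Theta ->
  exists N C, [/\ compact N, M `<=` N, N `<=` Theta, 0 <= C &
                  mean_value_on Theta M N C].
Proof.
move=> arcs cM MT; have [N [k [cN NT Nk]]] := arcs M cM MT.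
(* The sign of [k] is not prescribed, and [|k|] is still a Lipschitz constant. *)
exists N, `|k|; split => //.
  (* Every point of [M] is the start of an arc inside [N]. *)
  move=> x Mx; have [c [<- _ cN' _]] := Nk x x Mx Mx.
  by apply: cN'; exists 0 => //=; rewrite in_itv/= lexx ler01.
move=> h A e hA e0 Ae x y Mx My; have [c [<- <- cN' ck]] := Nk x y Mx My.
rewrite mulrC; apply: (mean_value_arc NT hA e0 Ae (normr_ge0 k) cN').
move=> st /ck /= /le_trans; apply; rewrite ler_wpM2r//; exact: ler_norm.
Qed.

(** Near-covering compactness for the filter of positive reals tending to 0: asking for all small
    [e] locally is what lets the local scales be merged into one. *)
Lemma compact_uniform_radius {R : realType} {V : normedModType R} (K : set V)
    (P : R -> V -> Prop) :
  compact K ->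
  (forall x, K x -> exists2 s : R, 0 < s &
     forall y e, `|y - x| < s -> 0 < e -> e < s -> P e y) ->
  exists2 e : R, 0 < e & forall x, K x -> P e x.
Proof.
move=> /compact_near_coveringP cK KP.
have KPnear : \forall e \near 0^'+, K `<=` P e.
  apply: cK => x Kx; have [s s0 Ps] := KP x Kx.
  exists ([set y | `|y - x| < s], [set e | 0 < e /\ e < s]).
    split => /=; first exact: near_dist_lt.
    by apply: filterI; [exact: nbhs_right_gt|exact: nbhs_right_lt].
  by move=> [y e] /= [ys [e0 es]]; exact: Ps.
have [e [e0 Ke]] : exists e : R, 0 < e /\ K `<=` P e.
  by apply: (@filter_ex _ 0^'+); apply: filterI KPnear; exact: nbhs_right_gt.
by exists e.
Qed.

(* Images of consecutive points of a fine subdivision of a segment are joined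
   by segments inside a compact neighbourhood of the image of the ball. *)
Lemma ball_image_mean_value {R : realType} {p : nat} (Theta : set 'rV[R]_p)
    (phi : 'rV[R]_p -> 'rV[R]_p) (c : R) :
  open Theta -> continuous phi -> (forall u, Theta (phi u)) -> 0 < c ->
  let M := phi @` [set u | `|u| <= c] in
  exists N C, [/\ compact N, M `<=` N, N `<=` Theta, 0 <= C &
                  mean_value_on Theta M N C].
Proof.
move=> oT cphi phiT c0 M; pose D := [set u : 'rV[R]_p | `|u| <= c].
have cD : compact D.
  rewrite (_ : D = [set y | `|y - 0| <= c]); first exact: compact_closed_ball_rV.
  by apply/seteqP; split=> u; rewrite /D /= subr0.
have cM : compact M.
  by apply: continuous_compact cD; exact: continuous_subspaceT.
have MT : M `<=` Theta by move=> _ [u _ <-].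
(* The closed [r]-neighbourhood of the compact [M] stays inside the open [Theta]. *)
have [r r0 rT] : exists2 r : R, 0 < r &
    forall x, M x -> forall y, `|y - x| <= r -> Theta y.
  apply: compact_uniform_radius => // x /MT Tx.
  have /nbhs_ballP[s /= s0 sT] := open_nbhs_nbhs (conj oT Tx).
  exists (s / 2); first by rewrite divr_gt0.
  move=> y e yx e0 es z zy; apply: sT; rewrite -ball_normE /ball_ /= distrC.
  rewrite -(subrKA y) (le_lt_trans (ler_normD _ _))//; lra.
(* Uniform continuity of [phi] on the ball, at the scale [r]. *)
have [eta eta0 phiu] : exists2 eta : R, 0 < eta &
    forall u, D u -> forall v, `|v - u| <= eta -> `|phi v - phi u| <= r.
  apply: compact_uniform_radius => // u _.
  have r2 : 0 < r / 2 by rewrite divr_gt0.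
  have /cvgrPdist_lt/(_ _ r2)/nbhs_ballP[s /= s0 su] := cphi u.
  have {}su w : `|w - u| < s -> `|phi u - phi w| < r / 2.
    by move=> wu; apply: su; rewrite -ball_normE /ball_ /= distrC.
  exists (s / 2); first by rewrite divr_gt0.
  move=> w e wu e0 es v vw.
  have h1 : `|phi u - phi w| < r / 2 by apply: su; lra.
  have h2 : `|phi u - phi v| < r / 2.
    apply: su; rewrite -(subrKA w) (le_lt_trans (ler_normD _ _))//; lra.
  rewrite -(subrKA (phi u)) (le_trans (ler_normD _ _))// [`|phi v - _|]distrC; lra.
pose N := (fun z : 'rV[R]_p * 'rV[R]_p => z.1 + z.2) @`
  (M `*` [set y : 'rV[R]_p | `|y - 0| <= r]).
have cN : compact N.
  apply: continuous_compact; last first.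
    by apply: compact_setX => //; exact: compact_closed_ball_rV.
  by apply: continuous_subspaceT => z; exact: add_continuous.
have NP x y : M x -> `|y - x| <= r -> N y.
  by move=> Mx yx; exists (x, y - x); rewrite /= ?subr0// addrC subrK.
have NT : N `<=` Theta.
  move=> _ [[x y] /= [Mx /[!subr0] yr] <-].
  by apply: (rT x Mx); rewrite addrAC subrr add0r.
(* Points of the ball are at most [2 * c] apart, so [m] pieces have length at most [eta]; the
   successor makes [m] positive and rounds up. *)
pose m := (Num.truncn (2 * c / eta)).+1.
have m0 : 0 < m%:R :> R by rewrite ltr0n.
have meta : 2 * c <= eta * m%:R.
  rewrite [eta * _]mulrC -ler_pdivrMr//; exact: ltW (truncnS_gt _).
(* Each of the [m] segments between consecutive images has length at most [r] and contributes at
   most [e * r]. *)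
exists N, (m%:R * r); split => //.
- by move=> x Mx; apply: (NP x x Mx); rewrite subrr normr0 ltW.
- by rewrite mulr_ge0// ltW.
move=> h A e hA e0 Ae _ _ [u Du <-] [v Dv <-].
pose w (i : nat) := u + (i%:R / m%:R) *: (v - u).
have Dw i : (i <= m)%N -> D (w i).
  move=> im; rewrite /D /w /=.
  have im0 : 0 <= i%:R / m%:R :> R by rewrite divr_ge0.
  have im1 : i%:R / m%:R <= 1 :> R by rewrite ler_pdivrMr// mul1r ler_nat.
  move: (i%:R / m%:R) im0 im1 => t t0 t1.
  have -> : u + t *: (v - u) = (1 - t) *: u + t *: v.
    by apply/rowP => j; rewrite !mxE; lra.
  rewrite (le_trans (ler_normD _ _))// !normrZ !ger0_norm ?subr_ge0//.
  by move: Du Dv; rewrite /D /= => Du Dv; nra.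
have ww i : `|w i.+1 - w i| <= eta.
  rewrite /w opprD addrACA subrr add0r -scalerBl -mulrBl -natr1 addrAC subrr add0r.
  rewrite mul1r normrZ ger0_norm ?invr_ge0 ?ler0n// mulrC ler_pdivrMr//.
  apply: le_trans meta; rewrite (le_trans (ler_normB _ _))//.
  by move: Du Dv; rewrite /D /=; lra.
have hw i : (i <= m)%N -> `|h (phi (w i)) - h (phi (w 0))| <= i%:R * (e * r).
  elim: i => [_|i IH im]; first by rewrite subrr normr0 mul0r.
  rewrite -(subrKA (h (phi (w i)))) (le_trans (ler_normD _ _))//.
  rewrite -natr1 mulrDl mul1r addrC lerD ?IH ?(ltnW im)//.
  have phiw : `|phi (w i.+1) - phi (w i)| <= r by apply: phiu (ww i); exact/Dw/ltnW.
  have Mwi : M (phi (w i)) by exists (w i) => //; exact/Dw/ltnW.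
  apply: (le_trans (mean_value_segment NT hA e0 Ae _)); last by rewrite ler_wpM2l.
  move=> t; rewrite in_itv/= => /andP[t0 t1]; apply: (NP _ _ Mwi).
  rewrite addrAC subrr add0r normrZ ger0_norm// (le_trans _ phiw)//.
  by rewrite ler_piMl.
have := hw m (leqnn m); rewrite /w mul0r scale0r addr0 divff ?gt_eqF//.
by rewrite scale1r subrKC [e * r]mulrC mulrA.
Qed.

(** * Convergence in outer probability *)

Lemma cvge0P {R : realType} (u : nat -> \bar R) : (forall n, (0 <= u n)%E) ->
  u n @[n --> \oo] --> 0%E <->
  forall e : R, 0 < e -> \forall n \near \oo, (u n < e%:E)%E.
Proof.
move=> u0; split=> [u_cvg e e0|ue].
  apply: (u_cvg [set x | (x < e%:E)%E]); apply/nbhs_EFin.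
  apply: filterS (near_dist_lt (0 : R^o) e0) => x /=.
  by rewrite subr0 lte_fin => /ltr_normlW.
move=> A /nbhs_EFin/nbhs_ballP[e /= e0 eA]; have := ue e e0.
apply: filterS => n une; rewrite /= -(@fineK _ (u n)); last first.
  by rewrite ge0_fin_numE//; apply: lt_le_trans une _; rewrite leey.
apply: eA; rewrite /ball /= sub0r normrN ger0_norm ?fine_ge0//.
rewrite -lte_fin fineK// ge0_fin_numE//.
by apply: lt_le_trans une _; rewrite leey.
Qed.

Section outer_probability.
Context {R : realType} {d : measure_display} {T : measurableType d}
  (P : probability T R).

Lemma outer_negligible (N : set T) : P.-negligible N -> (P^*)%mu N = 0%E.
Proof.
move=> [B [mB PB NB]]; apply/eqP; rewrite eq_le; apply/andP; split.
  by rewrite -PB -measurable_mu_extE//; exact: le_mu_ext.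
exact: mu_ext_ge0.
Qed.

(** [A] is covered by [B] and the exceptional null set, so subadditivity suffices without
    measurability. *)
Lemma outer_le_ae (A B : set T) : {ae P, forall w, A w -> B w} ->
  ((P^*)%mu A <= (P^*)%mu B)%E.
Proof.
move=> AB; rewrite -[leRHS]adde0 -(outer_negligible AB).
apply: le_trans (outer_measureU2 _ _ _); apply: le_mu_ext => w Aw.
by have [Bw|nBw] := pselect (B w); [left|right => /(_ Aw)].
Qed.

Lemma measurable_cover_lt (A : set T) (x : \bar R) : ((P^*)%mu A < x)%E ->
  exists C, [/\ measurable C, A `<=` C & (P C < x)%E].
Proof.
move=> /ereal_inf_lt[_ [F [mF AF] <-] Fx]; exists (\bigcup_k F k); split => //.
  exact: bigcupT_measurable.
by apply: le_lt_trans Fx; apply: measure_sigma_subadditive => //; exact: bigcupT_measurable.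
Qed.

Lemma cvg_in_prob0P (X : nat -> T -> \bar R) :
  cvg_in_prob0 P X <-> forall eps delta : R, 0 < eps -> 0 < delta ->
    \forall n \near \oo, ((P^*)%mu [set w | (eps%:E < X n w)%E] < delta%:E)%E.
Proof.
split=> [X0 eps delta eps0|X0 eps eps0].
  have /cvge0P := X0 eps eps0; apply => n; exact: mu_ext_ge0.
by apply/cvge0P => [n|delta delta0]; [exact: mu_ext_ge0|exact: X0].
Qed.

Lemma cvg_in_prob0_max (X Y : nat -> T -> \bar R) :
  cvg_in_prob0 P X -> cvg_in_prob0 P Y ->
  cvg_in_prob0 P (fun n w => maxe (X n w) (Y n w)).
Proof.
move=> /cvg_in_prob0P X0 /cvg_in_prob0P Y0; apply/cvg_in_prob0P => eps delta e0 d0.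
have d20 : 0 < delta / 2 by rewrite divr_gt0.
apply: (filterS2 _ _ (X0 _ _ e0 d20) (Y0 _ _ e0 d20)) => n Xn Yn.
have -> : [set w | (eps%:E < maxe (X n w) (Y n w))%E] =
    [set w | (eps%:E < X n w)%E] `|` [set w | (eps%:E < Y n w)%E].
  by apply/seteqP; split=> w /=; rewrite lt_max => /orP.
apply: le_lt_trans (outer_measureU2 _ _ _) _.
by rewrite [delta]splitr EFinD lteD.
Qed.

(** Domination is phrased through real bounds [e], the form in which the mean value inequality
    delivers it; infinite values of [X] then need no arithmetic. *)
Lemma cvg_in_prob0_dominated (X Y : nat -> T -> \bar R) (C : R) : 0 < C ->
  (forall n, {ae P, forall w, forall e : R,
     0 < e -> (X n w <= e%:E)%E -> (Y n w <= (C * e)%:E)%E}) ->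
  cvg_in_prob0 P X -> cvg_in_prob0 P Y.
Proof.
move=> C0 XY /cvg_in_prob0P X0; apply/cvg_in_prob0P => eps delta e0 d0.
have eC0 : 0 < eps / C by rewrite divr_gt0.
have := X0 _ _ eC0 d0; apply: filterS => n; apply: le_lt_trans.
apply: outer_le_ae; have := XY n; apply: filterS => w /= XYw; rewrite !ltNge.
by apply: contraNN => /(XYw _ eC0); rewrite mulrC divfK// gt_eqF.
Qed.

(* The sublevel sets of the random [delta] need not be measurable.  Let [C n k]
   be nearly optimal measurable covers of [{X n > 1/(k+1)}]; the measurable sets
   [\bigcup_(j >= k) \bigcup_n (A n `\` C n j)] decrease to a null set. *)
Lemma prob_cvg0 (A : nat -> set T) (X : nat -> T -> \bar R) :
  (forall n, measurable (A n)) -> cvg_in_prob0 P X ->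
  {ae P, forall w, exists2 delta : R, 0 < delta &
     forall n, A n w -> (delta%:E <= X n w)%E} ->
  P (A n) @[n --> \oo] --> 0%E.
Proof.
move=> mA /cvg_in_prob0P X0 Agood; apply/cvge0P => // eps eps0.
have eps20 : 0 < eps / 2 by rewrite divr_gt0.
pose dk k : R := k.+1%:R^-1; have dk0 k : 0 < dk k by rewrite invr_gt0.
have /choice[C CP] : forall nk : nat * nat, exists C, [/\ measurable C,
    [set w | ((dk nk.2)%:E < X nk.1 w)%E] `<=` C &
    ((P^*)%mu [set w | ((dk nk.2)%:E < X nk.1 w)%E] < (eps / 2)%:E)%E ->
    (P C < (eps / 2)%:E)%E].
  move=> [n k] /=; have [/measurable_cover_lt[C [mC XC PC]]|nlt] :=
    pselect ((P^*)%mu [set w | ((dk k)%:E < X n w)%E] < (eps / 2)%:E)%E.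
    by exists C.
  (* Where the outer probability is not yet small, the whole space is an admissible cover. *)
  by exists setT; split.
pose U k := \bigcup_n (A n `\` C (n, k)).
have mU k : measurable (U k).
  by apply: bigcupT_measurable => n; apply: measurableD => //; have [] := CP (n, k).
pose V k := \bigcup_j U (k + j)%N.
have mV k : measurable (V k) by exact: bigcupT_measurable.
have V0 : P (\bigcap_k V k) = 0%E.
  apply/negligibleP; first exact: bigcapT_measurable.
  (* If [w] is in every [V k], take [k] with [dk k < delta]: some [A n] contains [w] while
     [C (n, k + j)] does not, so [X n w <= dk (k + j) < delta], against the choice of [delta]. *)
  apply: negligibleS Agood => w Vw [delta delta0 Adelta].
  have [k _ /(_ k (leqnn k)) kdelta] := near_infty_natSinv_lt (PosNum delta0).
  have [j _ [n _ [Anw nCw]]] := Vw k I.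
  have [_ XC _] := CP (n, (k + j)%N).
  have := Adelta n Anw; rewrite leNgt => /negP; apply.
  rewrite ltNge; apply/negP => dX; apply: nCw; apply: XC => /=.
  apply: lt_le_trans dX; rewrite lte_fin; apply: le_lt_trans kdelta.
  by rewrite /dk lef_pV2 ?posrE// ler_nat ltnS leq_addr.
have Vcvg : P (V k) @[k --> \oo] --> 0%E.
  rewrite -V0; apply: nonincreasing_cvg_mu => //.
  - by rewrite (le_lt_trans (probability_le1 _ _))// ltry.
  - exact: bigcapT_measurable.
  move=> m n mn; rewrite subsetEset => w [j _ Uw].
  by exists (n - m + j)%N => //; rewrite addnA subnKC.
(* With this [k] fixed, [A n] is covered by [C (n, k)] and [V k], each of probability below
   [eps / 2] for large [n]. *)
have /cvge0P/(_ _ eps20)[//|k _ /(_ k (leqnn k)) Vk] := Vcvg.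
have := X0 (dk k) (eps / 2) (dk0 k) eps20; apply: filterS => n.
have [mC _ /[apply] PC] := CP (n, k).
apply: (@le_lt_trans _ _ (P (C (n, k) `|` V k))).
  apply: le_measure; rewrite ?inE//; first exact: measurableU.
  move=> w Anw; have [Cw|nCw] := pselect (C (n, k) w); first by left.
  by right; exists 0%N => //; exists n => //; rewrite addn0.
apply: le_lt_trans (measureU2 _ _ _) _ => //.
by rewrite [eps]splitr EFinD lteD.
Qed.

End outer_probability.

(** * Measurability of events defined by estimators *)

Lemma enorm_continuous {R : realType} {p : nat} :
  continuous (@enorm R p).
Proof.
move=> x; apply: continuous_comp; last exact: sqrt_continuous.
apply: (@cvg_big _ _ _ _ _ (@add_continuous _) _ (nbhs x)) => i _.
apply: (@continuous_comp _ _ _ (fun v : 'rV[R]_p => v 0 i) (fun t => t ^+ 2)).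
  exact: coord_continuous.
exact: exprn_continuous.
Qed.

Lemma open_enorm_gt {R : realType} {p : nat} (y : 'rV[R]_p) (eps : R) :
  open [set x : 'rV[R]_p | eps < enorm (x - y)].
Proof.
apply: (@open_comp _ _ (fun x : 'rV[R]_p => enorm (x - y)) [set t | eps < t]).
  move=> x _; apply: continuous_comp; last exact: enorm_continuous.
  by apply: (@cvgB _ _ _ (nbhs x) _ id (cst y)); [exact: cvg_id|exact: cvg_cst].
exact: open_gt.
Qed.

Lemma borel_open {R : realType} {p : nat} (U : set 'rV[R]_p) : open U -> borel U.
Proof. exact: sub_gen_smallest. Qed.

Section estimator_events.
Context {R : realType} {p : nat} {d : measure_display} {T : measurableType d}.
Variable F : set (set T).
Hypothesis Fm : F `<=` measurable.
Implicit Type th : T -> option 'rV[R]_p.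

Lemma measurable_option_in th (B : set 'rV[R]_p) : delta_measurable F th ->
  borel B -> measurable [set w | exists2 x, th w = Some x & B x].
Proof. by move=> mth bB; apply: Fm; exact: mth. Qed.

Lemma measurable_option_none th : delta_measurable F th ->
  measurable [set w | th w = None].
Proof.
move=> mth; have := measurable_option_in mth (borel_open openT).
move=> /measurableC; congr (measurable _); apply/seteqP.
split=> w /=; last by move=> -> [].
by case: (th w) => // x nx; exfalso; apply: nx; exists x.
Qed.

Lemma measurable_option_dist th (y : 'rV[R]_p) (eps : R) :
  delta_measurable F th ->
  measurable [set w | eps < dist_delta (th w) (Some y)].
Proof.
move=> mth; have mS := measurable_option_in mth (borel_open (@open_enorm_gt _ _ y eps)).
(* The extra point is at distance 1 from [y], so it belongs to the event exactly when [eps < 1]. *)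
have [eps1|eps1] := ltP eps 1.
  have := measurableU _ _ mS (measurable_option_none mth).
  congr (measurable _); apply/seteqP; split=> w /=.
    by move=> [[x ->//]|->].
  by case: (th w) => [x xe|]; [left; exists x|right].
move: mS; congr (measurable _); apply/seteqP; split=> w /=.
  by move=> [x ->].
by case: (th w) => [x xe|]; [exists x|rewrite /= ltNge eps1].
Qed.

End estimator_events.

(** Distinct points of R^p are strictly separated by a rational in some coordinate. The event is
    thus a countable union of intersections of events that each involve one estimator only. *)
Lemma measurable_option_neq {R : realType} {p : nat} {d : measure_display}
    {T : measurableType d} (F F' : set (set T)) (th th' : T -> option 'rV[R]_p) :
  F `<=` measurable -> F' `<=` measurable ->
  delta_measurable F th -> delta_measurable F' th' ->
  measurable [set w | th w <> th' w].
Proof.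
move=> Fm F'm mth mth'.
pose lo (i : 'I_p) (q : rat) := [set x : 'rV[R]_p | x 0 i < ratr q].
pose hi (i : 'I_p) (q : rat) := [set x : 'rV[R]_p | ratr q < x 0 i].
have blo i q : borel (lo i q).
  apply: borel_open; apply: (@open_comp _ _ (fun x : 'rV[R]_p => x 0 i) [set t | t < ratr q]).
    by move=> x _; exact: coord_continuous.
  exact: open_lt.
have bhi i q : borel (hi i q).
  apply: borel_open; apply: (@open_comp _ _ (fun x : 'rV[R]_p => x 0 i) [set t | ratr q < t]).
    by move=> x _; exact: coord_continuous.
  exact: open_gt.
pose E (f : T -> option 'rV[R]_p) B := [set w | exists2 x, f w = Some x & B x].
pose N (f : T -> option 'rV[R]_p) := [set w | f w = None].
pose D := \bigcup_(iq : 'I_p * rat)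
  ((E th (lo iq.1 iq.2) `&` E th' (hi iq.1 iq.2)) `|`
   (E th (hi iq.1 iq.2) `&` E th' (lo iq.1 iq.2))).
have -> : [set w | th w <> th' w] =
    (N th `&` E th' setT) `|` (E th setT `&` N th') `|` D.
  apply/seteqP; split=> w /=.
    case thw : (th w) => [x|]; case th'w : (th' w) => [y|] // xy; last first.
    - by left; left; split => //; exists y.
    - by left; right; split => //; exists x.
    right; have /rV0Pn[i] : x - y != 0.
      by rewrite subr_eq0; apply/eqP => xy'; apply: xy; rewrite xy'.
    rewrite !mxE subr_eq0 neq_lt => /orP[]/rat_in_itvoo[q];
      rewrite in_itv/= => /andP[q1 q2]; exists (i, q) => //.
    - by left; split; [exists x|exists y].
    - by right; split; [exists x|exists y].
  move=> [[[-> [y -> _]]//|[[x -> _] ->]//]|[[i q] _ /=]].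
  by case=> -[[x -> xq] [y -> yq]] [xy]; move: xq yq; rewrite /lo /hi /= xy => /lt_trans h /h;
    rewrite ltxx.
have mE B : borel B -> measurable (E th B) by exact: (measurable_option_in Fm mth).
have mE' B : borel B -> measurable (E th' B) by exact: (measurable_option_in F'm mth').
apply: measurableU.
  apply: measurableU; apply: measurableI.
  - exact: (measurable_option_none Fm mth).
  - by apply: mE'; apply: borel_open; exact: openT.
  - by apply: mE; apply: borel_open; exact: openT.
  - exact: (measurable_option_none F'm mth').
apply: countable_bigcupT_measurable => // iq.
by apply: measurableU; apply: measurableI;
  [exact: mE (blo _ _)|exact: mE' (bhi _ _)|exact: mE (bhi _ _)|exact: mE' (blo _ _)].
Qed.

(** * Asymptotics of estimators *)

Lemma estimator_some {R : realType} {p : nat} {T : Type} (F : set (set T))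
    (Theta : set 'rV[R]_p) (g : 'rV[R]_p -> T -> 'rV[R]_p)
    (th : T -> option 'rV[R]_p) w x :
  is_estimator F Theta g th -> th w = Some x -> Theta x /\ g x w = 0.
Proof.
move=> [_ root noroot] thx.
have [/root[y [thy Ty gy]]|/noroot] := pselect (root_event Theta g w).
  by move: thy; rewrite thx => -[->].
by rewrite thx.
Qed.

Lemma estimator_unique_root {R : realType} {p : nat} {T : Type} (F : set (set T))
    (Theta : set 'rV[R]_p) (g : 'rV[R]_p -> T -> 'rV[R]_p)
    (th : T -> option 'rV[R]_p) w x :
  is_estimator F Theta g th -> Theta x -> g x w = 0 ->
  (forall y, Theta y -> g y w = 0 -> y = x) -> th w = Some x.
Proof.
move=> [_ root _] Tx gx ux; have [|y [-> Ty gy]] := root w; first by exists x.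
by rewrite (ux y).
Qed.

Lemma ereal_inf_gt0_ex {R : realType} (S : set \bar R) : (0 < ereal_inf S)%E ->
  exists2 delta : R, 0 < delta & forall x, S x -> (delta%:E <= x)%E.
Proof.
case infS : (ereal_inf S) => [r| |] // r0.
  by exists r => // x Sx; rewrite -infS; exact: ereal_inf_lbound.
(* The infimum is infinite, for instance over the empty set, and any positive threshold serves. *)
exists 1 => // x Sx; have := ereal_inf_lbound Sx.
by rewrite infS leye_eq => /eqP ->; rewrite leey.
Qed.

Section asymptotics.
Context {R : realType} {d : measure_display} {T : measurableType d}
  (P : probability T R) {p : nat} (Theta : set 'rV[R]_p)
  (F : nat -> set (set T)) (Gn : nat -> 'rV[R]_p -> T -> 'rV[R]_p)
  (thbar : 'rV[R]_p) (Fm : forall n, F n `<=` measurable).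
Implicit Types (th : nat -> T -> option 'rV[R]_p) (X : nat -> T -> \bar R)
  (G : 'rV[R]_p -> T -> 'rV[R]_p) (M N : set 'rV[R]_p).

(** At a root [x] of [Gn n] the discrepancy between [Gn n] and [G] is [enorm (G x w)], which on the
    event is bounded below by the positive infimum; [prob_cvg0] then applies. *)
Lemma separated_estimator G M th (eps : R) :
  preimage_set_system Theta idfun borel M ->
  unif_cvg_in_prob P M Gn G -> well_separated P M thbar G ->
  (forall n, is_estimator (F n) Theta (Gn n) (th n)) -> 0 < eps ->
  P [set w | exists2 x, th n w = Some x & M x /\ eps < enorm (x - thbar)]
    @[n --> \oo] --> 0%E.
Proof.
move=> [B bB BM] GnG sepG est eps0; apply: (prob_cvg0 _ GnG) => [n|].
  have [mth _ _] := est n.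
  (* [M] is the trace on [Theta] of a Borel set [B], and estimates lie in [Theta], so [B] may
     replace [M]. *)
  have := measurableI _ _ (measurable_option_in (@Fm n) mth bB)
    (measurable_option_in (@Fm n) mth (borel_open (@open_enorm_gt _ _ thbar eps))).
  congr (measurable _); apply/seteqP; split=> w /=.
    move=> [[x thx Bx] [y thy ye]]; exists x => //.
    have [Tx _] := estimator_some (est n) thx.
    by split; [rewrite -BM|move: ye; move: thy; rewrite thx => -[->]].
  by move=> [x thx []]; rewrite -BM => -[Tx Bx] xe; split; exists x.
have := sepG eps eps0; apply: filterS => w /ereal_inf_gt0_ex[delta delta0 Gdelta].
exists delta => // n [x thx [Mx xe]].
have [_ Gnx] := estimator_some (est n) thx.
apply: (@le_trans _ _ (enorm (Gn n x w - G x w))%:E).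
  by rewrite Gnx sub0r -scaleN1r enormZ normrN1 mul1r; apply: Gdelta; exists x.
by apply: ereal_sup_ubound; exists x.
Qed.

Lemma consistent_of_near X th :
  (forall n, delta_measurable (F n) (th n)) -> cvg_in_prob0 P X ->
  {ae P, forall w, forall eps : R, 0 < eps -> exists2 delta : R, 0 < delta &
     forall n, (X n w < delta%:E)%E ->
       exists2 x, th n w = Some x & `|x - thbar| <= eps} ->
  weakly_consistent P thbar th.
Proof.
move=> mth X0 thX eps eps0.
have mA n : measurable [set w | eps < dist_delta (th n w) (Some thbar)].
  exact: (measurable_option_dist (@Fm n)).
have AE n : [set w | (eps%:E < (dist_delta (th n w) (Some thbar))%:E)%E] =
    [set w | eps < dist_delta (th n w) (Some thbar)].
  by apply/seteqP; split=> w /=; rewrite lte_fin.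
under eq_fun do rewrite AE measurable_mu_extE//.
apply: (prob_cvg0 mA X0); move: thX; apply: filterS => w thX.
have p0 : 0 < p%:R + 1 :> R by rewrite ltr_wpDl.
(* The factor [p + 1] is the loss in passing from the max norm to the Euclidean norm. *)
have [delta delta0 Xdelta] := thX (eps / (p%:R + 1)) (divr_gt0 eps0 p0).
exists delta => // n /= A; rewrite leNgt; apply/negP => /Xdelta[x thx xe].
move: A; rewrite thx /= ltNge => /negP; apply.
apply: le_trans (enorm_le_norm _) _.
by rewrite mulrC -ler_pdivlMr.
Qed.

Lemma eventually_unique X th th' :
  (forall n, delta_measurable (F n) (th n)) ->
  (forall n, delta_measurable (F n) (th' n)) -> cvg_in_prob0 P X ->
  {ae P, forall w, exists2 delta : R, 0 < delta &
     forall n, (X n w < delta%:E)%E -> th n w = th' n w} ->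
  P [set w | th n w <> th' n w] @[n --> \oo] --> 0%E.
Proof.
move=> mth mth' X0 thX; apply: (prob_cvg0 _ X0) => [n|].
  exact: (measurable_option_neq (@Fm n) (@Fm n)).
move: thX; apply: filterS => w [delta delta0 Xdelta]; exists delta => // n nth.
by rewrite leNgt; apply/negP => /Xdelta.
Qed.

(** The discrepancy in the C1 sense, anchored at [thbar]: only [Gn] enters the first term because
    [G] vanishes there almost surely. *)
Definition perturbation G N n w : \bar R :=
  maxe (enorm (Gn n thbar w))%:E
    (ereal_sup [set (opnorm (jacobian_in Theta (Gn n ^~ w) x -
                             jacobian_in Theta (G ^~ w) x))%:E | x in N]).

Lemma perturbation_le G N n w (e : R) : 0 <= e ->
  (perturbation G N n w <= e%:E)%E ->
  `|Gn n thbar w| <= e /\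
  forall x, N x -> opbound (jacobian_in Theta (Gn n ^~ w) x -
                            jacobian_in Theta (G ^~ w) x) ((p%:R + 1) * e).
Proof.
move=> e0; rewrite ge_max => /andP[]; rewrite lee_fin => Gne supe; split.
  exact: le_trans (norm_le_enorm _) Gne.
move=> x Nx; apply: opbound_opnorm => //; rewrite -lee_fin.
by apply: le_trans supe; apply: ereal_sup_ubound; exists x.
Qed.

Lemma C1_on_derivative (g : 'rV[R]_p -> 'rV[R]_p) N x :
  N `<=` Theta -> C1_on Theta N g -> N x ->
  derivative_in Theta g x (jacobian_in Theta g x).
Proof. by move=> NT [gN _] Nx; exact: jacobian_in_derivative (NT _ Nx) (gN _ Nx). Qed.

(** Continuity relative to [N] is full continuity at an interior point of [N]. *)
Lemma C1_on_jacobian_cvg (g : 'rV[R]_p -> 'rV[R]_p) N x :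
  C1_on Theta N g -> nbhs x N ->
  jacobian_in Theta g y @[y --> x] --> jacobian_in Theta g x.
Proof.
move=> [_ /subspace_continuousP cg] Nx A /(cg x (nbhs_singleton Nx)).
rewrite /= => NA; have : nbhs x (N `&` [set y | N y -> A (jacobian_in Theta g y)]).
  exact: filterI.
by apply: filterS => y [Ny]; exact.
Qed.

Section perturbation_ae.
Context (G : 'rV[R]_p -> T -> 'rV[R]_p) (M N : set 'rV[R]_p) (C : R)
  (cM : compact M) (MN : M `<=` N) (NT : N `<=` Theta) (Mthbar : nbhs thbar M)
  (C0 : 0 <= C) (mvN : mean_value_on Theta M N C)
  (C1N : {ae P, forall w, C1_on Theta N (G ^~ w) /\
                          forall n, C1_on Theta N (Gn n ^~ w)})
  (rootG : {ae P, forall w, forall x, Theta x -> (G x w = 0 <-> x = thbar)}).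

Let MT : M `<=` Theta. Proof. by move=> x /MN/NT. Qed.
Let Tthbar : Theta thbar. Proof. exact: MT (nbhs_singleton Mthbar). Qed.

Lemma perturbation_unif_cvg :
  cvg_in_prob0 P (perturbation G N) -> unif_cvg_in_prob P M Gn G.
Proof.
have p0 : 0 < p%:R + 1 :> R by rewrite ltr_wpDl.
(* The inner [p + 1] converts [opnorm] to [opbound], [C] is the mean value constant, the 1 accounts
   for the value at [thbar], and the outer [p + 1] returns to the Euclidean norm. *)
apply: (@cvg_in_prob0_dominated _ _ _ _ _ _
  ((p%:R + 1) * (C * (p%:R + 1) + 1))) => [|n].
  by rewrite mulr_gt0// ltr_wpDl// mulr_ge0// ltW.
apply: (filterS2 _ _ C1N rootG) => w [CG CGn] Gw e e0.
move=> /(perturbation_le (ltW e0))[Gne Je].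
apply: ge_ereal_sup => _ [x Mx <-]; rewrite lee_fin.
apply: (le_trans (enorm_le_norm _)); rewrite -mulrA ler_wpM2l ?(ltW p0)//.
have := mvN (h := fun y => Gn n y w - G y w) (A := fun y =>
  jacobian_in Theta (Gn n ^~ w) y - jacobian_in Theta (G ^~ w) y)
  (e := (p%:R + 1) * e).
move=> /(_ _ _ Je thbar x (nbhs_singleton Mthbar) Mx) /= mv.
rewrite (iffRL (Gw _ Tthbar))// subr0 in mv.
rewrite -(subrK (Gn n thbar w) (Gn n x w - G x w)) (le_trans (ler_normD _ _))//.
rewrite mulrDl mul1r -mulrA lerD//; apply: mv => [y Ny|].
  exact: (derivative_inB (C1_on_derivative NT (CGn n) Ny) (C1_on_derivative NT CG Ny)).
by rewrite mulr_ge0// ltW.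
Qed.

Lemma C1_well_separated : well_separated P M thbar G.
Proof.
have p0 : 0 < p%:R + 1 :> R by rewrite ltr_wpDl.
move=> eps eps0; apply: (filterS2 _ _ C1N rootG) => w [CG _] Gw.
have cG : {within M, continuous (G ^~ w)}.
  apply: (derivative_in_continuous MT) => x Mx.
  exact: (C1_on_derivative NT CG (MN Mx)).
have GM x : M x -> G x w = 0 -> x = thbar by move=> /MT/Gw[].
have [delta delta0 Gdelta] := root_separation cM cG GM (divr_gt0 eps0 p0).
apply: (@lt_le_trans _ _ delta%:E) => //.
apply: le_ereal_inf_tmp => _ [x [Mx xe] <-]; rewrite lee_fin.
apply: le_trans (norm_le_enorm _); apply: Gdelta => //.
by rewrite ler_pdivrMr// mulrC ltW// (lt_le_trans xe)// enorm_le_norm.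
Qed.

(** The exceptional null set depends neither on [eps] nor on [n]. The threshold [delta] is random
    with no claim of measurability, as [prob_cvg0] permits. *)
Lemma perturbed_root_ae :
  {ae P, forall w, jacobian_in Theta (G ^~ w) thbar \in unitmx} ->
  {ae P, forall w, forall eps : R, 0 < eps -> exists2 delta : R, 0 < delta &
     forall n, (perturbation G N n w < delta%:E)%E ->
       exists x, [/\ M x, Gn n x w = 0, `|x - thbar| <= eps &
                     forall y, M y -> Gn n y w = 0 -> y = x]}.
Proof.
have p0 : 0 < p%:R + 1 :> R by rewrite ltr_wpDl.
move=> Ju; apply: (filterS3 _ _ C1N rootG Ju) => w [CG CGn] Gw Juw eps eps0.
have Nthbar : nbhs thbar N by apply: filterS Mthbar.
have [delta delta0 root] := perturbed_root MN NT cM Mthbar C0 mvN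
  (fun x Nx => C1_on_derivative NT CG Nx) (C1_on_jacobian_cvg CG Nthbar) Juw
  (iffRL (Gw _ Tthbar) erefl) (fun x Mx => iffLR (Gw x (MT Mx))) eps0.
exists (delta / (p%:R + 1)); first by rewrite divr_gt0.
move=> n /ltW/perturbation_le[|Gne Je]; first by rewrite ltW// divr_gt0.
apply: (root _ (jacobian_in Theta (Gn n ^~ w))) => [x Nx||x /Je].
- exact: (C1_on_derivative NT (CGn n) Nx).
- by rewrite (le_trans Gne)// ler_pdivrMr// ler_peMr ?(ltW delta0)// lerDr.
- by rewrite mulrC divfK// gt_eqF.
Qed.

End perturbation_ae.

End asymptotics.

(** * Consistency and uniqueness under convergence of derivatives *)

Section C1_convergence.
Context {R : realType} {d : measure_display} {T : measurableType d}
  (P : probability T R) {p : nat} (Theta : set 'rV[R]_p)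
  (F : nat -> set (set T)) (Gn : nat -> 'rV[R]_p -> T -> 'rV[R]_p)
  (thbar : 'rV[R]_p) (G : 'rV[R]_p -> T -> 'rV[R]_p).

(** Repeats conditions (i) to (iii) verbatim, so that the lemmas take them as one hypothesis. *)
Definition C1_convergence : Prop :=
  forall M : set 'rV[R]_p, compact M -> M `<=` Theta ->
    [/\ cvg_in_prob0 P (fun n w => (enorm (Gn n thbar w))%:E) /\
        {ae P, forall w, G thbar w = 0},
        {ae P, forall w, C1_on Theta M (G ^~ w) /\
                         forall n, C1_on Theta M (Gn n ^~ w)} /\
        cvg_in_prob0 P (fun n w =>
          ereal_sup [set (opnorm (jacobian_in Theta (Gn n ^~ w) x -
                                  jacobian_in Theta (G ^~ w) x))%:E | x in M]) &
        {ae P, forall w, jacobian_in Theta (G ^~ w) thbar \in unitmx}].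

Hypotheses (Gn_G : C1_convergence) (Ttheta : Theta° thbar)
  (rootG : {ae P, forall w, forall x, Theta x -> (G x w = 0 <-> x = thbar)}).

Lemma perturbation_cvg0 N : compact N -> N `<=` Theta ->
  cvg_in_prob0 P (perturbation Theta Gn thbar G N).
Proof.
by move=> cN NT; have [[? _] [_ ?] _] := Gn_G cN NT; exact: cvg_in_prob0_max.
Qed.

Lemma unif_cvg_well_separated M :
  bounded_arcs Theta -> compact M -> M `<=` Theta -> nbhs thbar M ->
  unif_cvg_in_prob P M Gn G /\ well_separated P M thbar G.
Proof.
move=> arcs cM MT Mthbar.
have [N [C [cN MN NT C0 mvN]]] := bounded_arcs_mean_value arcs cM MT.
have [_ [C1N _] _] := Gn_G cN NT.
split; last exact: (C1_well_separated cM MN NT C1N rootG).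
apply: (perturbation_unif_cvg MN NT Mthbar C0 mvN C1N rootG).
exact: perturbation_cvg0.
Qed.

(** With [M] equal to [Theta], the root near [thbar] is the only one. It is chosen before the
    estimator, so the statement yields both consistency and agreement of two estimators. *)
Lemma compact_estimator_near : compact Theta -> bounded_arcs Theta ->
  exists2 X, cvg_in_prob0 P X &
    {ae P, forall w, forall eps : R, 0 < eps -> exists2 delta : R, 0 < delta &
       forall n, (X n w < delta%:E)%E -> exists2 x, `|x - thbar| <= eps &
         forall th, is_estimator (F n) Theta (Gn n) th -> th w = Some x}.
Proof.
move=> cT arcs; have TT : Theta `<=` Theta by [].
have [N [C [cN MN NT C0 mvN]]] := bounded_arcs_mean_value arcs cT TT.
have [_ [C1N _] Ju] := Gn_G cN NT.
exists (perturbation Theta Gn thbar G N); first exact: perturbation_cvg0.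
have := perturbed_root_ae cT MN NT Ttheta C0 mvN C1N rootG Ju.
apply: filterS => w Xw eps /Xw[delta delta0 Xdelta]; exists delta => // n.
move=> /Xdelta[x [Tx Gx xe ux]]; exists x => // th est.
exact: (estimator_unique_root est Tx Gx ux).
Qed.

Section homeomorphism.
Variable psi : 'rV[R]_p -> 'rV[R]_p.
Hypotheses (oT : open Theta) (homeo : homeo_to_Rp Theta psi).
Implicit Types rho : 'rV[R]_p.

(* If a root [x] satisfies [|psi x - psi thbar| <= 1], the root nearest to [rho]
   lies in the image of the ball of this radius. *)
Let radius rho : R :=
  `|psi rho| + (p%:R + 1) * (1 + `|psi thbar| + `|psi rho|).

Let radius_ge rho : `|psi thbar| + 1 <= radius rho.
Proof.
rewrite /radius addrC; have := normr_ge0 (psi rho); have := normr_ge0 (psi thbar).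
by have : 0 <= p%:R :> R by []; nra.
Qed.

(** The set [M], the image under [phi] of the ball of radius [c], contains the selected root for
    every centre with [radius rho <= c], and the root in [M] is unique. The uniformity in [rho]
    allows two centres to be compared. *)
Lemma centered_estimator_near (c : R) : `|psi thbar| + 1 <= c ->
  exists2 X, cvg_in_prob0 P X &
    {ae P, forall w, forall eps : R, 0 < eps -> exists2 delta : R, 0 < delta &
       forall n, (X n w < delta%:E)%E -> exists2 x, `|x - thbar| <= eps &
         forall rho th, radius rho <= c ->
           is_centered_estimator (F n) Theta psi rho (Gn n) th -> th w = Some x}.
Proof.
have [[_ _ psi_surj] cpsi [phi cphi phiK]] := homeo.
have psi_norm := normr_ge0 (psi thbar).
move=> rc; have c0 : 0 < c by lra.
have phiT u : Theta (phi u).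
  by have [x Tx <-] := psi_surj u I; rewrite phiK.
pose M := phi @` [set u | `|u| <= c].
have MP x : Theta x -> `|psi x| <= c -> M x.
  by move=> Tx xc; exists (psi x) => //; exact: phiK.
have cM : compact M.
  apply: continuous_compact; first exact: continuous_subspaceT.
  rewrite (_ : mkset _ = [set y | `|y - 0| <= c]); first exact: compact_closed_ball_rV.
  by apply/seteqP; split=> u /=; rewrite subr0.
have [N [C [cN MN NT C0 mvN]]] := ball_image_mean_value oT cphi phiT c0.
have Tthbar : Theta thbar by exact: interior_subset.
have psi1 : \forall x \near thbar, Theta x /\ `|psi thbar - psi x| <= 1.
  have /subspace_continuousP/(_ _ Tthbar)/cvgrPdist_le/(_ 1 ltr01) := cpsi.
  rewrite near_withinE => psi_near.
  have Tnear : \forall x \near thbar, Theta x by exact: open_nbhs_nbhs.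
  by apply: (filterS2 _ _ Tnear psi_near) => x Tx /(_ Tx).
have Mthbar : nbhs thbar M.
  apply: filterS psi1 => x [Tx x1]; apply: MP => //.
  rewrite -(subrK (psi thbar) (psi x)) (le_trans (ler_normD _ _))// distrC; lra.
have /nbhs_ballP[r /= r0 rpsi] := psi1.
have [_ [C1N _] Ju] := Gn_G cN NT.
exists (perturbation Theta Gn thbar G N); first exact: perturbation_cvg0.
have := perturbed_root_ae cM MN NT Mthbar C0 mvN C1N rootG Ju.
apply: filterS => w Xw eps eps0.
(* The second bound keeps [x] where [psi] differs from [psi thbar] by at most 1, as [radius]
   presupposes. *)
have eps'0 : 0 < Num.min eps (r / 2) by rewrite lt_min eps0 divr_gt0.
have [delta delta0 Xdelta] := Xw _ eps'0.
exists delta => // n /Xdelta[x [Mx Gx]]; rewrite le_min => /andP[xe xr] ux.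
exists x => // rho th rho_c [_ root _].
have [Tx x1] : Theta x /\ `|psi thbar - psi x| <= 1.
  by apply: rpsi; rewrite -ball_normE /ball_ /= distrC; lra.
have [|y [-> Ty Gy ymin]] := root w; first by exists x.
congr Some; apply: ux => //; apply: MP => //; apply: le_trans rho_c.
(* The distance of [psi y] from [psi rho] is at most that of [psi x], by minimality of [y]; the
   factor [p + 1] bounds the Euclidean norm by the max norm. *)
rewrite -(subrK (psi rho) (psi y)) (le_trans (ler_normD _ _))// addrC lerD2l.
apply: le_trans (norm_le_enorm _) _; apply: le_trans (ymin _ Tx Gx) _.
apply: le_trans (enorm_le_norm _) _; rewrite ler_wpM2l ?addr_ge0//.
rewrite (le_trans (ler_normB _ _))// lerD2r.
rewrite -(subrK (psi thbar) (psi x)) (le_trans (ler_normD _ _))// distrC lerD2r.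
by [].
Qed.

Hypothesis Fm : forall n, F n `<=` measurable.

Lemma centered_consistent rho th :
  (forall n, is_centered_estimator (F n) Theta psi rho (Gn n) (th n)) ->
  weakly_consistent P thbar th.
Proof.
move=> est; have [X X0 Xth] := centered_estimator_near (radius_ge rho).
apply: (consistent_of_near Fm _ X0) => [n|]; first by have [] := est n.
move: Xth; apply: filterS => w Xw eps /Xw[delta delta0 Xdelta].
exists delta => // n /Xdelta[x xe thx]; exists x => //.
exact: (thx rho (th n)).
Qed.

Lemma centered_eventually_unique rho rho' th th' :
  (forall n, is_centered_estimator (F n) Theta psi rho (Gn n) (th n)) ->
  (forall n, is_centered_estimator (F n) Theta psi rho' (Gn n) (th' n)) ->
  P [set w | th n w <> th' n w] @[n --> \oo] --> 0%E.
Proof.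
(* A ball large enough for both centres forces both estimators onto the same root. *)
move=> est est'; pose c := Num.max (radius rho) (radius rho').
have rc : radius rho <= c by rewrite le_max lexx.
have rc' : radius rho' <= c by rewrite le_max lexx orbT.
have [X X0 Xth] := centered_estimator_near (le_trans (radius_ge rho) rc).
apply: (eventually_unique Fm _ _ X0) => [n|n|].
- by have [] := est n.
- by have [] := est' n.
move: Xth; apply: filterS => w /(_ 1 ltr01)[delta delta0 Xdelta].
exists delta => // n /Xdelta[x _ thx].
by rewrite (thx rho (th n))// (thx rho' (th' n)).
Qed.

End homeomorphism.
End C1_convergence.

Theorem theorem2p7 (R : realType) (d : measure_display) (T : measurableType d)
    (P : probability T R) (p : nat) (Theta : set 'rV[R]_p)
    (F : nat -> set (set T)) (Gn : nat -> 'rV[R]_p -> T -> 'rV[R]_p)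
    (thbar : 'rV[R]_p)
    (complete_P : measure_is_complete P)
    (complete_F : forall n, complete_subfield P (F n))
    (measurable_Gn : forall n, jointly_measurable (F n) Theta (Gn n))
    (Theta_thbar : Theta thbar) :
  (* 1) *)
  (forall (M : set 'rV[R]_p) (G : 'rV[R]_p -> T -> 'rV[R]_p),
     M `<=` Theta ->
     within Theta (nbhs thbar) M ->
     preimage_set_system Theta idfun borel M ->
     jointly_measurable measurable M G ->
     unif_cvg_in_prob P M Gn G ->
     well_separated P M thbar G ->
     forall th : nat -> T -> option 'rV[R]_p,
       (forall n, is_estimator (F n) Theta (Gn n) (th n)) ->
       forall eps : R, 0 < eps ->
         P [set w | exists2 x, th n w = Some x & M x /\ eps < enorm (x - thbar)]
           @[n --> \oo] --> 0%E)
  /\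
  (* 2) *)
  (forall G : 'rV[R]_p -> T -> 'rV[R]_p,
     Theta° thbar ->
     jointly_measurable measurable Theta G ->
     (forall M : set 'rV[R]_p, compact M -> M `<=` Theta ->
        [/\ (* (i) *)
            cvg_in_prob0 P (fun n w => (enorm (Gn n thbar w))%:E) /\
            {ae P, forall w, G thbar w = 0},
            (* (ii) *)
            {ae P, forall w, C1_on Theta M (G ^~ w) /\
                             forall n, C1_on Theta M (Gn n ^~ w)} /\
            cvg_in_prob0 P (fun n w =>
              ereal_sup [set (opnorm (jacobian_in Theta (Gn n ^~ w) x -
                                      jacobian_in Theta (G ^~ w) x))%:E | x in M]) &
            (* (iii) *)
            {ae P, forall w, jacobian_in Theta (G ^~ w) thbar \in unitmx}]) ->
     {ae P, forall w, forall x, Theta x -> (G x w = 0 <-> x = thbar)} ->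
     [/\ bounded_arcs Theta ->
           forall M : set 'rV[R]_p, compact M -> M `<=` Theta -> nbhs thbar M ->
             unif_cvg_in_prob P M Gn G /\ well_separated P M thbar G,
         (* (a) *)
         compact Theta -> bounded_arcs Theta ->
           (forall th : nat -> T -> option 'rV[R]_p,
              (forall n, is_estimator (F n) Theta (Gn n) (th n)) ->
              weakly_consistent P thbar th) /\
           (forall th th' : nat -> T -> option 'rV[R]_p,
              (forall n, is_estimator (F n) Theta (Gn n) (th n)) ->
              (forall n, is_estimator (F n) Theta (Gn n) (th' n)) ->
              P [set w | th n w <> th' n w] @[n --> \oo] --> 0%E) &
         (* (b) *)
         forall psi : 'rV[R]_p -> 'rV[R]_p,
           open Theta -> homeo_to_Rp Theta psi ->
           (forall (rho : 'rV[R]_p) (th : nat -> T -> option 'rV[R]_p),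
              Theta rho ->
              (forall n, is_centered_estimator (F n) Theta psi rho (Gn n) (th n)) ->
              weakly_consistent P thbar th) /\
           (forall (rho rho' : 'rV[R]_p) (th th' : nat -> T -> option 'rV[R]_p),
              Theta rho -> Theta rho' ->
              (forall n, is_centered_estimator (F n) Theta psi rho (Gn n) (th n)) ->
              (forall n, is_centered_estimator (F n) Theta psi rho' (Gn n) (th' n)) ->
              P [set w | th n w <> th' n w] @[n --> \oo] --> 0%E)]).
Proof.
have Fm n : F n `<=` measurable by have [] := complete_F n.
split=> [M G _ _ BM _ GnG sepG th est eps eps0|G iT _ Gn_G rootG].
  exact: (separated_estimator Fm BM GnG sepG est eps0).
split=> [arcs M|cT arcs|psi oT homeo].
- exact: (unif_cvg_well_separated Gn_G rootG arcs).
- have [X X0 Xth] := compact_estimator_near F Gn_G iT rootG cT arcs.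
  split=> [th est|th th' est est'].
    apply: (consistent_of_near Fm _ X0) => [n|]; first by have [] := est n.
    move: Xth; apply: filterS => w Xw eps /Xw[delta delta0 Xdelta].
    by exists delta => // n /Xdelta[x xe thx]; exists x => //; exact: thx.
  apply: (eventually_unique Fm _ _ X0) => [n|n|].
  - by have [] := est n.
  - by have [] := est' n.
  (* Agreement of the estimators does not involve [eps], so the value 1 is as good as any. *)
  move: Xth; apply: filterS => w /(_ 1 ltr01)[delta delta0 Xdelta].
  by exists delta => // n /Xdelta[x _ thx]; rewrite !thx.
- split=> [rho th _ est|rho rho' th th' _ _ est est'].
    exact: (centered_consistent Gn_G iT rootG oT homeo Fm est).
  exact: (centered_eventually_unique Gn_G iT rootG oT homeo Fm est est').
Qed.
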